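(* Let $H\leq F_m$ be a non-trivial finitely generated subgroup. Let $H_n$ be the set of elements of $H$ of length $n$ with respect to the basis $A$ of $F_m$, $H(z)=\sum_{n\geq0}|H_n|z^n$ and $L_H(z)=\sum_{w\in L_H}z^{|w|}$. Let $M_{\mathcal{D}_H}$ be the adjacency matrix of the Moore diagram of $\mathcal{D}_H$, with the states ordered so that the initial state $q^*$ is first. Let $\mathbf{i}$ be the $1\times|Q_{\mathcal{D}_H}|$ row vector $(1,0,\dots,0)$ and $\mathbf{f}$ the $|Q_{\mathcal{D}_H}|\times1$ column vector that is the characteristic vector of the set of final states of $\mathcal{D}_H$. Then $$H(z)=L_H(z)=\mathbf{i}\cdot(I-zM_{\mathcal{D}_H})^{-1}\cdot\mathbf{f},$$ where $I$ is the identity matrix of size $|Q_{\mathcal{D}_H}|\times|Q_{\mathcal{D}_H}|$.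
   Context: The identity is one of power series in $z$. The adjacency matrix of a directed graph has as $(q,q')$ entry the number of edges from $q$ to $q'$. The Moore diagram of an automaton is the directed graph on its states with an edge labelled $x$ from $q$ to $q'$ whenever the automaton can move from $q$ to $q'$ on reading $x$. Free group and core. $A=\{a_1,\dots,a_m\}$ is a fixed basis of $F_m$ and $\Sigma=A\cup A^{-1}$. The length of an element of $F_m$ is the length of the reduced word over $\Sigma$ representing it; a word is reduced if it has no subword $xx^{-1}$, $x\in\Sigma$. $L_H\subseteq\Sigma^*$ is the set of reduced words (including the empty word) representing elements of $H$. The extended Schreier graph $\widehat\Gamma$ of $H$ has as vertices the right cosets $Hg$, $g\in F_m$, with exactly one edge labelled $x$ from $Hg$ to $Hgx$ for every vertex $Hg$ and every $x\in\Sigma$. The root is $v_0=H$. The extended core $\widehat\Delta_H=(\widehat V,\widehat E,\widehat\mu)$ is the subgraph of $\widehat\Gamma$ consisting of $v_0$ and all vertices and edges lying on closed paths based at $v_0$ with reduced label; it is finite when $H$ is finitely generated. $\widehat\mu(e),t(e)$ are the label and terminus of an edge $e$. If $\widehat E$ contains an edge with origin $v$ and label $x$, its terminus is denoted $vx$. The automaton $\mathcal{D}_H$. It has alphabet $\Sigma$, states $Q_{\mathcal{D}_H}=\{q^*\}\cup\{(v,x)\mid v\in\widehat V,\ x\in\Sigma,\ \exists e\in\widehat E \text{ with } \widehat\mu(e)=x,\ t(e)=v\}$, unique initial state $q^*$, final states $\{q^*\}\cup\{(v_0,x)\mid (v_0,x)\in Q_{\mathcal{D}_H}\}$, and transitions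 $\delta(q^*,x)=(v_0x,x)$ whenever $\widehat E$ has an edge labelled $x$ with origin $v_0$, and $\delta((v,x),y)=(vy,y)$ whenever $y\neq x^{-1}$ and $\widehat E$ has an edge labelled $y$ with origin $v$; all other transitions are undefined. *)

(* Defs.v *)
From HB Require Import structures.
From mathcomp Require Import all_boot all_order all_algebra finmap.
From mathcomp Require Import boolp classical_sets functions cardinality fsbigop.

Set Implicit Arguments.
Unset Strict Implicit.
Unset Printing Implicit Defensive.

Import GRing.Theory.
Local Open Scope classical_set_scope.
Local Open Scope ring_scope.

Record fps (R : Type) := Fps { fps_coef : nat -> R }.

Lemma fpsP (R : Type) (f g : fps R) :
  (forall n, fps_coef f n = fps_coef g n) -> f = g.
Proof. by case: f g => [f] [g] /= e; congr Fps; apply: funext. Qed.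

HB.instance Definition _ (R : Type) := gen_eqMixin (fps R).
HB.instance Definition _ (R : Type) := gen_choiceMixin (fps R).

Section FpsRing.
Variable R : comNzRingType.
Implicit Types f g h : fps R.

Definition fps0 : fps R := Fps (fun _ => 0).
Definition fps1 : fps R := Fps (fun n => (n == 0)%:R).
Definition fps_opp f : fps R := Fps (fun n => - fps_coef f n).
Definition fps_add f g : fps R := Fps (fun n => fps_coef f n + fps_coef g n).
Definition fps_mul f g : fps R :=
  Fps (fun n => \sum_(i < n.+1) fps_coef f i * fps_coef g (n - i)).

Fact fps_addA : associative fps_add.
Proof. by move=> f g h; apply: fpsP => n /=; rewrite addrA. Qed.
Fact fps_addC : commutative fps_add.
Proof. by move=> f g; apply: fpsP => n /=; rewrite addrC. Qed.
Fact fps_add0 : left_id fps0 fps_add.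
Proof. by move=> f; apply: fpsP => n /=; rewrite add0r. Qed.
Fact fps_addN : left_inverse fps0 fps_opp fps_add.
Proof. by move=> f; apply: fpsP => n /=; rewrite addNr. Qed.

HB.instance Definition _ :=
  GRing.isZmodule.Build (fps R) fps_addA fps_addC fps_add0 fps_addN.

Let trunc n f : {poly R} := \poly_(i < n.+1) fps_coef f i.

Let trunc_coef n f i : (i <= n)%N -> (trunc n f)`_i = fps_coef f i.
Proof. by move=> le_in; rewrite coef_poly ltnS le_in. Qed.

Let mul_coefE n k (p q : {poly R}) f g : (k <= n)%N ->
  (forall i, (i <= n)%N -> p`_i = fps_coef f i) ->
  (forall i, (i <= n)%N -> q`_i = fps_coef g i) ->
  (p * q)`_k = fps_coef (fps_mul f g) k.
Proof.
move=> le_kn pf qg; rewrite coefM /=; apply: eq_bigr => i _.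
have le_ik : (i <= k)%N by rewrite -ltnS.
by rewrite pf ?qg // (leq_trans _ le_kn) // leq_subr.
Qed.

Fact fps_mulA : associative fps_mul.
Proof.
move=> f g h; apply: fpsP => n.
have T := trunc_coef.
rewrite -(@mul_coefE n n (trunc n f) (trunc n g * trunc n h)) //;
  [|exact: T|by move=> i le_in; apply: mul_coefE le_in _ _; exact: T].
rewrite mulrA (@mul_coefE n n _ _ (fps_mul f g) h) //; last exact: T.
by move=> i le_in; apply: mul_coefE le_in _ _; exact: T.
Qed.

Fact fps_mulC : commutative fps_mul.
Proof.
move=> f g; apply: fpsP => n.
rewrite -(@mul_coefE n n (trunc n f) (trunc n g)) //; try exact: trunc_coef.
by rewrite mulrC (@mul_coefE n n _ _ g f) //; exact: trunc_coef.
Qed.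

Fact fps_mul1 : left_id fps1 fps_mul.
Proof.
move=> f; apply: fpsP => n /=.
rewrite big_ord_recl /= mul1r subn0 big1 ?addr0 // => i _.
by rewrite mul0r.
Qed.

Fact fps_mulDl : left_distributive fps_mul fps_add.
Proof.
move=> f g h; apply: fpsP => n /=; rewrite -big_split /=.
by apply: eq_bigr => i _; rewrite mulrDl.
Qed.

Fact fps1_neq0 : fps1 != 0.
Proof.
apply/eqP => /(congr1 (fun f => fps_coef f 0)) /= /eqP.
by rewrite oner_eq0.
Qed.

HB.instance Definition _ := GRing.Zmodule_isComNzRing.Build (fps R)
  fps_mulA fps_mulC fps_mul1 fps_mulDl fps1_neq0.

Definition fps_unit : pred (fps R) := fun f => `[< exists g, g * f = 1 >].

Definition fps_inv f : fps R := xget f [set g | g * f = 1].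

Fact fps_mulVr : {in fps_unit, left_inverse 1 fps_inv *%R}.
Proof. by move=> f /asboolP[g gf]; apply: (@xgetPex _ f [set g | g * f = 1]); exists g. Qed.

Fact fps_unitP f g : g * f = 1 -> fps_unit f.
Proof. by move=> gf; apply/asboolP; exists g. Qed.

Fact fps_inv_out : {in [predC fps_unit], fps_inv =1 id}.
Proof.
move=> f /negP nu; rewrite /fps_inv xgetPN // => g gf.
by case: nu; apply: fps_unitP gf.
Qed.

HB.instance Definition _ := GRing.ComNzRing_hasMulInverse.Build (fps R)
  fps_mulVr fps_unitP fps_inv_out.

Definition fpsX : fps R := Fps (fun n => (n == 1)%:R).

(* Sum of a family of series, coefficient by coefficient; meaningful when, for
   each n, only finitely many members have a nonzero coefficient of degree n. *)
Definition fps_sum (T : choiceType) (A : set T) (F : T -> fps R) : fps R :=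
  Fps (fun n => \sum_(t \in A) fps_coef (F t) n).

End FpsRing.

Arguments fpsX {R}.

(* (i, false) stands for a_i and (i, true) for its inverse. *)
Notation letter m := ('I_m * bool)%type.

Section FreeGroup.
Variable m : nat.
Implicit Types (x y : letter m) (u v w : seq (letter m)).

Definition linv x : letter m := (x.1, ~~ x.2).

Lemma linvK : involutive linv.
Proof. by case=> i b; rewrite /linv /= negbK. Qed.

Definition reduced w : bool := sorted (fun x y => y != linv x) w.

(* Reduced form of x :: w, for w reduced. *)
Definition cons_red x w : seq (letter m) :=
  if w is y :: w' then if y == linv x then w' else x :: w else [:: x].

(* Reduced form of u ++ v, for v reduced. *)
Definition rcat u v : seq (letter m) := foldr cons_red v u.

Lemma reduced_behead x w : reduced (x :: w) -> reduced w.
Proof. exact: path_sorted. Qed.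

Lemma cons_red_reduced x w : reduced w -> reduced (cons_red x w).
Proof.
case: w => //= y w rw; case: eqP => [_|/eqP ne]; first exact: path_sorted rw.
by rewrite /reduced /= ne.
Qed.

Lemma cons_redK x w : reduced w -> cons_red (linv x) (cons_red x w) = w.
Proof.
case: w => [_|y w] /=; first by rewrite linvK eqxx.
case: eqP => [->|_] /=; last by rewrite linvK eqxx.
by case: w => [//|z w] /andP[/negPf nz _] /=; rewrite nz.
Qed.

Lemma rcat_reduced u v : reduced v -> reduced (rcat u v).
Proof. by move=> rv; elim: u => //= x u; apply: cons_red_reduced. Qed.

Lemma rcat_cons_red x u v :
  reduced v -> rcat (cons_red x u) v = cons_red x (rcat u v).
Proof.
move=> rv; case: u => //= y u; case: eqP => // -> /=.
by rewrite -{1}[x]linvK cons_redK // rcat_reduced.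
Qed.

Lemma rcatA u v w : reduced w -> rcat u (rcat v w) = rcat (rcat u v) w.
Proof. by move=> rw; elim: u => //= x u ->; rewrite rcat_cons_red. Qed.

Lemma rcat0 w : reduced w -> rcat w [::] = w.
Proof.
elim: w => //= x w IHw rw; rewrite IHw ?(reduced_behead rw) //.
by case: w rw {IHw} => //= y w /andP[/negPf-> _].
Qed.

Definition winv w : seq (letter m) := rev (map linv w).

Lemma winv_reduced w : reduced w -> reduced (winv w).
Proof.
rewrite /reduced /winv rev_sorted sorted_map => rw; apply: sub_sorted rw => x y /=.
by rewrite linvK eq_sym.
Qed.

Lemma rcat_winvl w v : reduced v -> rcat (winv w) (rcat w v) = v.
Proof.
move=> rv; elim: w => //= x w IHw.
rewrite /winv /= rev_cons -cats1 {1}/rcat foldr_cat /=.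
by rewrite cons_redK ?rcat_reduced.
Qed.

Lemma winvK : involutive winv.
Proof. by move=> w; rewrite /winv map_rev revK mapK //; apply: linvK. Qed.

Definition freegroup := {w : seq (letter m) | reduced w}.
HB.instance Definition _ := Choice.on freegroup.

Implicit Types g h : freegroup.

Definition fg_one : freegroup := Sub [::] isT.
Definition fg_mul g h : freegroup :=
  Sub (rcat (val g) (val h)) (rcat_reduced (val g) (valP h)).
Definition fg_inv g : freegroup := Sub (winv (val g)) (winv_reduced (valP g)).

Fact fg_mulA : associative fg_mul.
Proof. by move=> g h k; apply: val_inj => /=; rewrite rcatA ?(valP k). Qed.
Fact fg_mul1g : left_id fg_one fg_mul.
Proof. by move=> g; apply: val_inj. Qed.
Fact fg_mulg1 : right_id fg_one fg_mul.
Proof. by move=> g; apply: val_inj; rewrite /= rcat0 ?(valP g). Qed.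
Fact fg_mulVg : left_inverse fg_one fg_inv fg_mul.
Proof.
by move=> g; apply: val_inj; rewrite /= -{2}[sval g]rcat0 ?rcat_winvl ?(valP g).
Qed.
Fact fg_mulgV : right_inverse fg_one fg_inv fg_mul.
Proof.
move=> g; apply: val_inj => /=; set w := sval g.
have rw : reduced (winv w) by apply: winv_reduced; exact: valP g.
by rewrite -{1}[w]winvK -{2}[winv w]rcat0 // rcat_winvl.
Qed.

HB.instance Definition _ := isGroup.Build freegroup
  fg_mulA fg_mul1g fg_mulg1 fg_mulVg fg_mulgV.

Definition fg_letter x : freegroup := Sub [:: x] isT.

Definition word_elt w : freegroup := (\prod_(x <- w) fg_letter x)%g.

Lemma word_elt_val w : val (word_elt w) = rcat w [::].
Proof. by rewrite /word_elt; elim: w => [|x w IHw]; rewrite ?big_nil ?big_cons //= IHw. Qed.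

(* val g is the only reduced word that represents g. *)
Lemma reduced_wordP w g : reduced w /\ word_elt w = g <-> w = val g.
Proof.
split=> [[rw <-]|->]; first by rewrite word_elt_val rcat0.
by split; [exact: valP | apply: val_inj; rewrite word_elt_val rcat0 // (valP g)].
Qed.

Definition fg_length g : nat := size (val g).

Definition is_subgroup (H : set freegroup) : Prop :=
  [/\ H 1%g, (forall g h, H g -> H h -> H (g * h)%g)
    & (forall g, H g -> H (g^-1)%g)].

Definition generated (s : seq freegroup) : set freegroup :=
  [set g | forall K, is_subgroup K -> (forall h, h \in s -> K h) -> K g].

Definition finitely_generated (H : set freegroup) : Prop :=
  exists s : seq freegroup, H = generated s.

Definition nontrivial (H : set freegroup) : Prop := exists2 g, H g & g != 1%g.

Variable H : set freegroup.

Definition elements_of_length (n : nat) : set freegroup :=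
  [set g | H g /\ fg_length g = n].

Definition growth_series : fps int :=
  Fps (fun n => #|` fset_set (elements_of_length n)|%:R).

Definition reduced_language : set (seq (letter m)) :=
  [set w | reduced w /\ H (word_elt w)].

Definition language_series : fps int :=
  fps_sum reduced_language (fun w => fpsX ^+ size w).

Definition right_coset (g : freegroup) : set freegroup := [set (h * g)%g | h in H].

Definition schreier_vertices : set (set freegroup) := range right_coset.

(* An edge is determined by its origin e.1 and its label e.2. *)
Definition edge := (set freegroup * letter m)%type.

Definition terminus (e : edge) : set freegroup :=
  [set (g * fg_letter e.2)%g | g in e.1].

Lemma terminus_right_coset g x :
  terminus (right_coset g, x) = right_coset (g * fg_letter x)%g.
Proof.
apply/seteqP; split=> k /=.
- by move=> [_ [h Hh <-] <-]; exists h => //; rewrite mulgA.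
- by move=> [h Hh <-]; exists (h * g)%g; [exists h | rewrite mulgA].
Qed.

Definition schreier_edges : set edge := [set e | schreier_vertices e.1].

(* H, as the right coset H * 1. *)
Definition schreier_root : set freegroup := H.

Fixpoint is_path (v : set freegroup) (p : seq edge) (v' : set freegroup) : Prop :=
  if p is e :: p' then [/\ schreier_edges e, e.1 = v & is_path (terminus e) p' v']
  else v = v'.

Definition closed_reduced_path (p : seq edge) : Prop :=
  is_path schreier_root p schreier_root /\ reduced [seq e.2 | e <- p].

Definition core_edges : set edge :=
  [set e | exists2 p, closed_reduced_path p & e \in p].

Definition core_vertices : set (set freegroup) :=
  schreier_root |` [set v | exists2 p, closed_reduced_path p &
                   exists2 e, e \in p & v = e.1 \/ v = terminus e].

End FreeGroup.

Record automaton (S : finType) := Automaton {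
  state : Type;
  states : set state;
  initial : state;
  final : set state;
  trans : state -> S -> state -> Prop }.

Arguments state {S} a.
Arguments states {S} a.
Arguments initial {S} a.
Arguments final {S} a.
Arguments trans {S} a.

(* Its (i, j) entry counts the letters labelling an edge from e i to e j in the Moore
   diagram. *)
Definition adjacency (S : finType) (D : automaton S) (n : nat)
    (e : 'I_n -> state D) : 'M[nat]_n :=
  \matrix_(i, j) #|[pred x : S | `[< trans D (e i) x (e j) >]]|.

Section CoreAutomaton.
Variables (m : nat) (H : set (freegroup m)).

(* None is the initial state q^*. *)
Definition core_state := option (set (freegroup m) * letter m).

Definition core_states : set core_state :=
  [set q | if q is Some (v, x) then core_vertices H v /\
             (exists2 e, core_edges H e & e.2 = x /\ terminus e = v)
           else True].

Definition core_final : set core_state :=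
  [set q | if q is Some (v, x) then v = schreier_root H /\ core_states q else True].

Inductive core_trans : core_state -> letter m -> core_state -> Prop :=
| core_trans_init x :
    core_edges H (schreier_root H, x) ->
    core_trans None x (Some (terminus (schreier_root H, x), x))
| core_trans_step v x y :
    core_states (Some (v, x)) -> y != linv x -> core_edges H (v, y) ->
    core_trans (Some (v, x)) y (Some (terminus (v, y), y)).

Definition core_automaton : automaton (letter m) :=
  @Automaton (letter m) core_state core_states None core_final core_trans.

End CoreAutomaton.

(* Main.v *)
(** The series [\sum_k z^k M^k] inverts [I - z M], and the [k]-th coefficient of
  [i (I - z M)^-1 f] is [i M^k f]. The automaton being deterministic, this
  counts the words of length [k] that it accepts. A word is accepted exactly when it is
  reduced, closed at [v_0] and runs inside the core; a reduced closed word runs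
  inside the core by definition of the core, so these are the reduced words of [H].

  The core is finite because of the following: let [V] be the finite set of cosets met
  while reading the reduced generators from [v_0]. The elements of [H] whose
  reduced word stays in the subgraph spanned by [V] form a subgroup, as free
  reduction only shortcuts a walk, so this subgroup is all of [H]. *)

Require Import Defs.
From mathcomp Require Import all_boot all_order all_algebra finmap.
From mathcomp Require Import boolp classical_sets functions cardinality fsbigop.

Set Implicit Arguments.
Unset Strict Implicit.
Unset Printing Implicit Defensive.

Import GRing.Theory.
Local Open Scope classical_set_scope.
Local Open Scope ring_scope.

(** * Coefficients of power series and the geometric series of a matrix *)

Lemma fps_coef_sum (R : comNzRingType) (I : Type) (r : seq I) (P : pred I)
    (F : I -> fps R) k :
  fps_coef (\sum_(i <- r | P i) F i) k = \sum_(i <- r | P i) fps_coef (F i) k.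
Proof. exact: (big_morph (fun f => fps_coef f k) (fun _ _ => erefl) erefl). Qed.

Lemma fps_coef_natM (R : comNzRingType) (a : nat) (f : fps R) k :
  fps_coef (a%:R * f) k = a%:R * fps_coef f k.
Proof.
by rewrite mulr_natl [RHS]mulr_natl; elim: a => //= a IHa; rewrite !mulrS -IHa.
Qed.

Lemma fps_coefXM (R : comNzRingType) (f : fps R) k :
  fps_coef (fpsX * f) k = if k is k'.+1 then fps_coef f k' else 0.
Proof.
case: k => [|k] /=; first by rewrite big_ord1 mul0r.
rewrite !big_ord_recl /= mul0r add0r mul1r subSS subn0 big1 ?addr0 // => i _.
by rewrite mul0r.
Qed.

Lemma fps_coefXn (R : comNzRingType) n k :
  fps_coef (fpsX ^+ n : fps R) k = (k == n)%:R.
Proof.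
by elim: n k => [//|n IHn] k; rewrite exprS fps_coefXM; case: k => // k; rewrite IHn.
Qed.

(** The geometric series of [z A], stored entry by entry so that it is a matrix over [fps R]. *)
Definition resolvent (R : comNzRingType) n (A : 'M[R]_n.+1) : 'M[fps R]_n.+1 :=
  \matrix_(i, j) Fps (fun k => (A ^+ k) i j).

(** The product telescopes: [fpsX] shifts degrees by one, and [A] times the coefficient [A ^+ k] is
    the coefficient of degree [k.+1]. *)
Lemma mul_resolvent (R : comNzRingType) n (A : 'M[nat]_n.+1) :
  (1%:M - fpsX *: map_mx (fun a => a%:R) A)
    *m resolvent (map_mx (fun a => a%:R) A) = 1%:M :> 'M[fps R]_n.+1.
Proof.
rewrite mulmxBl mul1mx -scalemxAl; apply/matrixP => i j; apply: fpsP => k.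
rewrite !mxE -[LHS]/(_ - fps_coef (_ * _) _) fps_coefXM /=.
case: k => [|k]; first by rewrite expr0 !mxE subr0; case: (i == j).
have -> : fps_coef ((i == j)%:R : fps R) k.+1 = 0 by case: (i == j).
rewrite fps_coef_sum exprS -mulmxE mxE; apply/eqP; rewrite subr_eq0; apply/eqP/eq_bigr => l _.
by rewrite !mxE fps_coef_natM.
Qed.

(** * Counting the words accepted by a deterministic automaton *)

Lemma big_tupleS (R : Type) (idx : R) (op : Monoid.com_law idx) (S : finType) k
    (F : k.+1.-tuple S -> R) :
  \big[op/idx]_w F w = \big[op/idx]_x \big[op/idx]_(w : k.-tuple S) F [tuple of x :: w].
Proof.
rewrite pair_bigA (reindex (fun p : S * k.-tuple S => [tuple of p.1 :: p.2])) //=.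
exists (fun w => (thead w, [tuple of behead w])) => [[x w] _|w _] /=.
  by congr pair; apply: val_inj.
by rewrite [RHS]tuple_eta.
Qed.

Lemma fsum_words (R : nzRingType) (S : finType) (P : set (seq S)) k :
  \sum_(w \in P `&` [set w | size w = k]) (1 : R) =
  \sum_(w : k.-tuple S) `[< P w >]%:R.
Proof.
have <- : (fun w : k.-tuple S => val w) @` [set w : k.-tuple S | P w] =
    P `&` [set w | size w = k].
  apply/seteqP; split=> w /=; first by move=> [u Pu <-]; rewrite size_tuple.
  by move=> [Pw /eqP sw]; exists (Tuple sw).
rewrite fsbig_image; last by move=> u w _ _; apply: val_inj.
under [RHS]eq_bigr => w _ do rewrite mulrb.
rewrite -big_mkcond [RHS]bigfs ?index_enum_uniq // => [|w _]; last by rewrite mem_index_enum.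
by apply: eq_fsbigl; apply/seteqP; split=> w /asboolP.
Qed.

Section Automaton.
Variables (S : finType) (D : automaton S).

Fixpoint accepts (q : state D) (w : seq S) : Prop :=
  if w is x :: w' then exists2 q', trans D q x q' & accepts q' w' else final D q.

Hypothesis trans_fun : forall q x q1 q2, trans D q x q1 -> trans D q x q2 -> q1 = q2.
Hypothesis trans_states : forall q x q', trans D q x q' -> states D q'.

(** Induction on [k], splitting off the first letter. By determinism a word has at most one run, so
    counting paths to final states counts words. *)
Lemma count_accepts (R : comNzRingType) n (e : 'I_n.+1 -> state D) k i :
  set_bij [set: 'I_n.+1] (states D) e ->
  \sum_j (map_mx (fun a => a%:R : R) (adjacency e) ^+ k) i j * (e j \in final D)%:R =
  \sum_(w : k.-tuple S) `[< accepts (e i) w >]%:R.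
Proof.
move=> [_ inj_e surj_e]; elim: k i => [|k IHk] i.
  under eq_bigr => j _ do rewrite expr0 mxE mulr_natl mulrb eq_sym.
  rewrite -big_mkcond big_pred1_eq (bigD1 [tuple]) //= big1 ?addr0 => [|w].
    by congr (_%:R).
  by case/eqP; apply: tuple0.
rewrite big_tupleS exprS -mulmxE.
under [LHS]eq_bigr => j _ do rewrite mxE mulr_suml.
rewrite exchange_big /=.
(* The adjacency entry becomes a sum over the letters leading from [e i] to [e l]; the letter sum
   can then be moved outside. *)
under [LHS]eq_bigr => l _.
  under eq_bigr => j _ do rewrite -mulrA.
  rewrite -mulr_sumr IHk !mxE -sum1_card natr_sum mulr_suml.
  under eq_bigr => x _ do rewrite mul1r.
  rewrite big_mkcond /=.
  over.
rewrite [LHS]exchange_big /=; apply: eq_bigr => x _.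
(* For a fixed letter at most one index [l] contributes, and none when the transition is
   undefined. *)
have [[q' tq]|ntq] := pselect (exists q', trans D (e i) x q'); last first.
  rewrite !big1 // => [w _|l _].
    by case: asboolP => // -[q' tq _]; case: ntq; exists q'.
  by case: ifP => // /asboolP tq; case: ntq; exists (e l).
have [l _ el] := surj_e _ (trans_states tq); rewrite -el in tq.
rewrite (bigD1 l) //= ifT; last exact/asboolP.
rewrite [X in _ + X]big1 ?addr0 => [|l' /eqP nel]; last first.
  case: ifP => // /asboolP tq'; case: nel; apply: inj_e; rewrite ?inE //.
  exact: trans_fun tq' tq.
apply: eq_bigr => w _; congr (_%:R); congr nat_of_bool; apply/asbool_equiv_eq.
by split=> [|[q1 tq1]]; [exists (e l) | rewrite (trans_fun tq1 tq)].
Qed.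

End Automaton.

Section FreeGroup.
Variable m : nat.
Implicit Types (H v : set (freegroup m)) (x y : letter m) (w : seq (letter m)).

(** * Coefficients of the growth and language series *)

Lemma word_elt_sval (g : freegroup m) : word_elt (val g) = g.
Proof. by case: (@reduced_wordP m (val g) g) => _ /(_ erefl)[]. Qed.

Lemma sval_word_elt w : reduced w -> val (word_elt w) = w.
Proof. by move=> rw; apply/esym/reduced_wordP. Qed.

Lemma word_elt_cons x w : word_elt (x :: w) = (fg_letter x * word_elt w)%g.
Proof. by rewrite /word_elt big_cons. Qed.

Lemma coef_language_series H k :
  fps_coef (language_series H) k =
  \sum_(w \in reduced_language H `&` [set w | size w = k]) (1 : int).
Proof.
rewrite /language_series /fps_sum /=.
under eq_fsbigr => w _ do rewrite fps_coefXn.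
(* Words of length other than [k] contribute zero in degree [k]. *)
rewrite -(@fsbig_widen _ _ _ _ (reduced_language H `&` [set w | size w = k])).
- by apply: eq_fsbigr => w; rewrite inE => -[_ /= ->]; rewrite eqxx.
- by move=> w [].
- by move=> w [Lw nw] /=; case: eqP => // kw; case: nw.
Qed.

Lemma coef_growth_series H k :
  fps_coef (growth_series H) k =
  \sum_(w \in reduced_language H `&` [set w | size w = k]) (1 : int).
Proof.
have <- : (fun g : freegroup m => val g) @` elements_of_length H k =
    reduced_language H `&` [set w | size w = k].
  apply/seteqP; split=> w /=.
    by move=> [g [Hg gk] <-]; do !split=> //=; rewrite ?word_elt_sval //; exact: (valP g).
  move=> [[redw Hw] wk]; exists (word_elt w); rewrite ?sval_word_elt //.
  by split; rewrite // /fg_length sval_word_elt.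
rewrite fsbig_image; last by move=> g h _ _; apply: val_inj.
(* [fset_set] is empty on an infinite set, so its cardinal is meaningful only once finiteness is
   known. *)
have finE : finite_set (elements_of_length H k).
  apply: (@sub_finite_set _ _ ((fun w : k.-tuple (letter m) => word_elt w) @` setT)).
    by move=> g [_ /eqP gk]; exists (Tuple gk); rewrite //= word_elt_sval.
  exact/finite_image/finite_finset.
by rewrite fsbig_finite //= card_fset_sum1 natr_sum.
Qed.

(** * Walks in the Schreier graph and free reduction *)

Definition run v w := foldl (fun v x => terminus (v, x)) v w.

Lemma terminusK v x : terminus (terminus (v, x), linv x) = v.
Proof.
have xV : (fg_letter x * fg_letter (linv x))%g = 1%g.
  by apply: val_inj; rewrite /= eqxx.
apply/seteqP; split=> g /=.
  by move=> [_ [h vh <-] <-]; rewrite -mulgA xV mulg1.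
by move=> vg; exists (g * fg_letter x)%g; [exists g | rewrite -mulgA xV mulg1].
Qed.

Lemma run_right_coset H g w :
  run (right_coset H g) w = right_coset H (g * word_elt w)%g.
Proof.
elim: w g => [|x w IHw] g /=; first by rewrite /word_elt big_nil mulg1.
by rewrite terminus_right_coset IHw word_elt_cons mulgA.
Qed.

Lemma right_coset1 H : right_coset H 1%g = H.
Proof.
apply/seteqP; split=> g /=; first by move=> [h Hh <-]; rewrite mulg1.
by move=> Hg; exists g; rewrite ?mulg1.
Qed.

Lemma run_root H w : is_subgroup H -> run H w = H <-> H (word_elt w).
Proof.
move=> [H1 HM HV]; rewrite -{1}(right_coset1 H) run_right_coset mul1g.
split=> [<-|Hw]; first by exists 1%g; rewrite ?mul1g.
apply/seteqP; split=> g /=; first by move=> [h Hh <-]; apply: HM.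
move=> Hg; exists (g * (word_elt w)^-1)%g; last by rewrite mulgVK.
by apply: HM => //; apply: HV.
Qed.

(** The edge set is a parameter because it is taken both as the core and as the edges spanned by a
    finite set of vertices. *)
Fixpoint traces (E : set (edge m)) v w : Prop :=
  if w is x :: w' then E (v, x) /\ traces E (terminus (v, x)) w' else True.

Lemma is_path_run H v p v' : is_path H v p v' -> run v [seq e.2 | e <- p] = v'.
Proof. by elim: p v => //= -[u x] p IHp v [_ /= <- /IHp]. Qed.

Lemma is_path_traces H v p v' E : is_path H v p v' ->
  traces E v [seq e.2 | e <- p] <-> forall e, e \in p -> E e.
Proof.
elim: p v => //= -[u x] p IHp v [_ /= <- /IHp {}IHp]; split.
  by move=> [Eux /IHp Ep] e; rewrite inE => /predU1P[->|/Ep].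
move=> Ep; split; first by apply: Ep; rewrite mem_head.
by apply/IHp => e ep; apply: Ep; rewrite inE ep orbT.
Qed.

Lemma run_is_path H v w : schreier_vertices H v ->
  exists2 p, is_path H v p (run v w) & [seq e.2 | e <- p] = w.
Proof.
elim: w v => [|x w IHw] v Hv /=; first by exists [::].
have [|p pathp pw] := IHw (terminus (v, x)).
  by case: Hv => g _ <-; exists (g * fg_letter x)%g; rewrite ?terminus_right_coset.
by exists ((v, x) :: p); rewrite /= ?pw.
Qed.

Lemma run_cons_red v x w : run v (cons_red x w) = run v (x :: w).
Proof. by case: w => //= y w; case: eqP => //= ->; rewrite terminusK. Qed.

Lemma run_rcat v u w : run v (rcat u w) = run (run v u) w.
Proof. by elim: u v => //= x u IHu v; rewrite run_cons_red /= IHu. Qed.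

(** A cancellation deletes a step and its immediate return, so the remaining walk uses no new
    edge. *)
Lemma traces_cons_red E v x w : traces E v (x :: w) -> traces E v (cons_red x w).
Proof.
case: w => //= y w [Evx]; case: eqP => [-> [_]|_ [Ey Ew]] //=.
by rewrite terminusK.
Qed.

Lemma traces_rcat E v u w :
  traces E v u -> traces E (run v u) w -> traces E v (rcat u w).
Proof.
elim: u v => //= x u IHu v [Evx Eu] Ew.
by apply: traces_cons_red; split=> //; apply: IHu.
Qed.

Lemma winv_cons x w : winv (x :: w) = rcons (winv w) (linv x).
Proof. by rewrite /winv /= rev_cons. Qed.

Lemma run_winv v w : run (run v w) (winv w) = v.
Proof.
elim: w v => //= x w IHw v.
by rewrite winv_cons /run foldl_rcons -/(run _ _) -/(run _ _) IHw terminusK.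
Qed.

Lemma traces_rcons E v w x :
  traces E v w -> E (run v w, x) -> traces E v (rcons w x).
Proof. by elim: w v => //= y w IHw v [Evy Ew] Ex; split=> //; apply: IHw. Qed.

(** The inverse word walks back along the inverse edges, which [E] contains by hypothesis. *)
Lemma traces_winv E v w : (forall u x, E (u, x) -> E (terminus (u, x), linv x)) ->
  traces E v w -> traces E (run v w) (winv w).
Proof.
move=> EV; elim: w v => //= x w IHw v [Evx Ew].
rewrite winv_cons; apply: traces_rcons; first exact: IHw.
by rewrite run_winv; apply: EV.
Qed.

(** * Finiteness of the core *)

Definition inner_edges (V : set (set (freegroup m))) : set (edge m) :=
  [set e | V e.1 /\ V (terminus e)].

Lemma traces_inner_edges V v w :
  (forall i, (i <= size w)%N -> V (run v (take i w))) -> traces (inner_edges V) v w.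
Proof.
elim: w v => //= x w IHw v Vw; split; last by apply: IHw => i le_iw; apply: (Vw i.+1).
by split; [apply: (Vw 0%N) | have := Vw 1%N isT; rewrite /= take0].
Qed.

Lemma traces_generated (s : seq (freegroup m)) E :
  let H := generated s in
  is_subgroup H -> (forall u x, E (u, x) -> E (terminus (u, x), linv x)) ->
  (forall g, g \in s -> traces E H (val g)) -> forall g, H g -> traces E H (val g).
Proof.
move=> H sH EV Es g Hg; have [H1 HM HV] := sH.
(* Membership in [H] is carried along: it makes each walk return to the root, where the next factor
   starts. *)
suff [] : H g /\ traces E H (val g) by [].
have runH h : H h -> run H (val h) = H.
  by move=> Hh; apply/(run_root _ sH); rewrite word_elt_sval.
(* [generated] quantifies over all subgroups; it is instantiated at the elements of [H] whose walk
   stays in [E]. *)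
apply: (Hg (fun h => H h /\ traces E H (val h))).
  split=> [//|h k [Hh Eh] [Hk Ek]|h [Hh Eh]].
    by split; [apply: HM | apply: traces_rcat; rewrite ?runH].
  by split; [apply: HV | have := traces_winv EV Eh; rewrite runH].
by move=> h hs; split; [move=> K _; apply | apply: Es].
Qed.

Lemma core_edges_sub_finite H : is_subgroup H -> finitely_generated H ->
  exists2 V, finite_set V & core_edges H `<=` inner_edges V.
Proof.
move=> sH [s Hs].
(* These are the cosets met while reading the generators; the successor includes the endpoint of the
   full word. *)
exists [set` [seq run H (take i (val g)) | g <- s, i <- iota 0 (size (val g)).+1]].
  exact: finite_seq.
set V := [set` _] => e [p [pathp redp] ep].
have := is_path_run pathp; set w := map _ _ in redp * => /(run_root _ sH) Hw.
suff : traces (inner_edges V) H w.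
  by move/(is_path_traces _ pathp); apply.
(* The label of the path is reduced, hence is the normal form of an element of [H]. *)
rewrite -(sval_word_elt redp).
move: sH Hw @V; rewrite Hs => sH Hw V.
apply: traces_generated => // [u x [Vu Vux]|g gs].
  by split=> //=; rewrite terminusK.
apply: traces_inner_edges => i le_ig.
by apply/allpairsPdep; exists g, i; rewrite mem_iota.
Qed.

Lemma finite_core_states H : is_subgroup H -> finitely_generated H ->
  finite_set (core_states H).
Proof.
move=> sH fgH; have [V finV sV] := core_edges_sub_finite sH fgH.
apply: (@sub_finite_set _ _ ([set None] `|` Some @` (V `*` [set: letter m]))).
  move=> [[v x]|_]; last by left.
  by move=> [_ [e /sV[_ Ve] [_ <-]]]; right; exists (terminus e, x).
rewrite finite_setU; split; first exact: finite_set1.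
by apply: finite_image; apply: finite_setX => //; apply: finite_finset.
Qed.

(** * The language of the core automaton *)

Lemma core_edge_state H v x :
  core_edges H (v, x) -> core_states H (Some (terminus (v, x), x)).
Proof.
move=> Evx; split; last by exists (v, x).
by case: Evx => p clp ep; right; exists p => //; exists (v, x) => //; right.
Qed.

Lemma core_trans_noneE H x q : core_trans H None x q <->
  core_edges H (H, x) /\ q = Some (terminus (H, x), x).
Proof.
split=> [t|[Ex ->]]; last exact: core_trans_init.
by inversion t.
Qed.

Lemma core_trans_someE H v x y q : core_trans H (Some (v, x)) y q <->
  [/\ core_states H (Some (v, x)), y != linv x, core_edges H (v, y)
    & q = Some (terminus (v, y), y)].
Proof.
split=> [t|[Qvx ne Ey ->]]; last exact: core_trans_step.
by inversion t.
Qed.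

(** The state remembers the last letter [x] and forbids its inverse next, so reducedness is tested
    on [x :: w]. *)
Lemma core_accepts_some H v x w : core_states H (Some (v, x)) ->
  @accepts _ (core_automaton H) (Some (v, x)) w <->
  [/\ traces (core_edges H) v w, run v w = H & reduced (x :: w)].
Proof.
elim: w v x => [|y w IHw] v x Qvx /=; first by split=> [[vH _]|[_ vH _]]; split.
split=> [[q' tq]|[[Evy Ew] runw /andP[ne redw]]].
  move: tq => /core_trans_someE[_ ne Ey ->].
  by move=> /(IHw _ _ (core_edge_state Ey))[Ew runw redw]; split=> //=; rewrite ne.
exists (Some (terminus (v, y), y)); first exact: core_trans_step.
by apply/(IHw _ _ (core_edge_state Evy)).
Qed.

Lemma core_accepts H w : is_subgroup H ->
  @accepts _ (core_automaton H) None w <-> reduced_language H w.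
Proof.
move=> sH.
have -> : reduced_language H w <->
    [/\ traces (core_edges H) H w, run H w = H & reduced w].
  split=> [[redw Hw]|[_ /(run_root _ sH) Hw redw] //].
  have runw : run H w = H by apply/run_root.
  have [|p] := @run_is_path H H w.
    by exists 1%g; rewrite ?right_coset1.
  rewrite runw => pathp pw; split=> //; rewrite -pw.
  (* The path reading [w] is itself closed and reduced, so it witnesses that each of its edges lies
     in the core. *)
  apply/(is_path_traces _ pathp) => e ep; exists p => //; split=> //.
  by rewrite pw.
(* From [None] no letter is remembered, so the first letter is treated apart. *)
case: w => [|x w] /=; first by split.
split=> [[q' tq]|[[Ex Ew] runw redw]].
  move: tq => /core_trans_noneE[Ex ->].
  by move=> /(core_accepts_some _ (core_edge_state Ex))[Ew runw redw].
exists (Some (terminus (H, x), x)); first exact: core_trans_init.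
by apply/(core_accepts_some _ (core_edge_state Ex)).
Qed.

Lemma core_trans_fun H q x q1 q2 :
  core_trans H q x q1 -> core_trans H q x q2 -> q1 = q2.
Proof.
case: q => [[v y]|]; last by move=> /core_trans_noneE[_ ->] /core_trans_noneE[_ ->].
by move=> /core_trans_someE[_ _ _ ->] /core_trans_someE[_ _ _ ->].
Qed.

Lemma core_trans_states H q x q' : core_trans H q x q' -> core_states H q'.
Proof. by case=> [y|v y z _ _] /core_edge_state. Qed.

End FreeGroup.

Theorem proposition6p3 (m : nat) (H : set (freegroup m)) :
  is_subgroup H -> nontrivial H -> finitely_generated H ->
  let D := core_automaton H in
  [/\ finite_set (states D),
      growth_series H = language_series H
    & forall (n : nat) (e : 'I_n.+1 -> state D),
        set_bij [set: 'I_n.+1] (states D) e -> e ord0 = initial D ->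
        let M : 'M[fps int]_n.+1 := map_mx (fun k : nat => k%:R) (adjacency e) in
        let i : 'rV[fps int]_n.+1 := delta_mx ord0 ord0 in
        let f : 'cV[fps int]_n.+1 := \col_j (e j \in final D)%:R in
        1%:M - fpsX *: M \in unitmx /\
        language_series H = (i *m invmx (1%:M - fpsX *: M) *m f) ord0 ord0].
Proof.
move=> sH _ fgH D; split; first exact: finite_core_states.
  by apply: fpsP => k; rewrite coef_growth_series coef_language_series.
(* Over a commutative ring a one-sided inverse of a square matrix makes it invertible. *)
move=> n e bij_e e0 M i f; have /mulmx1_unit[uM _] := mul_resolvent int (adjacency e).
split=> //.
have -> : invmx (1%:M - fpsX *: M) =
    resolvent (map_mx (fun a => a%:R) (adjacency e)).
  by rewrite -[RHS](mulKmx uM) mul_resolvent mulmx1.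
apply: fpsP => k; rewrite coef_language_series fsum_words -rowE mxE fps_coef_sum.
(* Both sides count the words of length [k] accepted from the initial state, which is [e ord0]. *)
transitivity (\sum_(w : k.-tuple (letter m)) `[< @accepts _ D (e ord0) w >]%:R : int).
  apply: eq_bigr => w _; congr (_%:R); congr nat_of_bool.
  by apply: asbool_equiv_eq; rewrite e0; apply: iff_sym; apply: core_accepts.
rewrite -(@count_accepts _ D (@core_trans_fun m H) (@core_trans_states m H) _ _ _ _ _ bij_e).
apply: eq_bigr => j _.
by rewrite !mxE mulrC [in RHS]mulrC fps_coef_natM.
Qed.
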